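(* For a ring $R$, the following conditions are equivalent: (1) $R$ is UnitUC and $J(R)$ is nil. (2) $R$ is strongly uniquely clean and $J(R)$ is nil. (3) $R$ is strongly $J$-clean and $J(R)$ is nil. (4) $R$ is strongly nil-clean.
   Context: Rings are associative with $1\neq 0$; $J(R)$ is the Jacobson radical, $U(R)$ the group of units, $Id(R)$ the set of idempotents of $R$. A ring $R$ is clean if every $a\in R$ can be written as $a=e+u$ with $e\in Id(R)$, $u\in U(R)$. For $e,f\in Id(R)$ write $e\sim f$ if there is $u\in U(R)$ with $e=u^{-1}fu$. $R$ is unit uniquely clean (UnitUC) if it is clean and, whenever $e+u=f+v$ with $e,f\in Id(R)$ and $u,v\in U(R)$, one has $e\sim f$. $R$ is strongly uniquely clean (also called uniquely strongly clean) if every $a\in R$ can be written uniquely as $a=e+u$ with $e\in Id(R)$, $u\in U(R)$ and $eu=ue$. $R$ is strongly $J$-clean if every $a\in R$ can be written as $a=e+j$ with $e\in Id(R)$, $j\in J(R)$ and $ej=je$. $R$ is strongly nil-clean if every $a\in R$ can be written as $a=e+b$ with $e\in Id(R)$, $b$ nilpotent and $eb=be$. *)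

(* Defs.v *)
From mathcomp Require Import all_boot all_algebra.

Set Implicit Arguments.
Unset Strict Implicit.
Unset Printing Implicit Defensive.

Import GRing.Theory.
Local Open Scope ring_scope.

Section RingNotions.

(* [unitRingType] adds no condition on the ring: by [unitrP], [GRing.unit] is
   the set of two-sided invertible elements, which exists classically. *)
Variable R : unitRingType.

Implicit Types (a b e f u v x : R).

Definition idempotent_elt e : Prop := e * e = e.

Definition nilpotent_elt b : Prop := exists n : nat, b ^+ n = 0.

Definition unit_conj e f : Prop :=
  exists2 u, u \is a GRing.unit & e = u^-1 * f * u.

(* [idealr_closed I] says that [I] contains 0, not 1, and is closed under
   [u, v |-> a * u + v]: it is a proper left ideal.  Under excluded middle,
   boolean predicates range over all subsets of [R]. *)
Definition maximal_left_ideal (I : {pred R}) : Prop :=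
  idealr_closed I /\
  forall K : {pred R}, idealr_closed K -> {subset I <= K} -> {subset K <= I}.

Definition jacobson x : Prop :=
  forall I : {pred R}, maximal_left_ideal I -> x \in I.

Definition jacobson_nil : Prop := forall x, jacobson x -> nilpotent_elt x.

Definition clean : Prop :=
  forall a, exists e u,
    [/\ idempotent_elt e, u \is a GRing.unit & a = e + u].

Definition unit_uniquely_clean : Prop :=
  clean /\
  forall e f u v,
    idempotent_elt e -> idempotent_elt f ->
    u \is a GRing.unit -> v \is a GRing.unit ->
    e + u = f + v -> unit_conj e f.

Definition strongly_uniquely_clean : Prop :=
  forall a, exists! p : R * R,
    [/\ idempotent_elt p.1, p.2 \is a GRing.unit,
        p.1 * p.2 = p.2 * p.1 & a = p.1 + p.2].

Definition strongly_J_clean : Prop :=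
  forall a, exists e j : R,
    [/\ idempotent_elt e, jacobson j, e * j = j * e & a = e + j].

Definition strongly_nil_clean : Prop :=
  forall a, exists e b,
    [/\ idempotent_elt e, nilpotent_elt b, e * b = b * e & a = e + b].

End RingNotions.

(* Main.v *)
Require Import Defs.
From Stdlib Require Import Ncring Ncring_tac.
From mathcomp Require Import all_boot all_algebra.
From mathcomp Require Import boolp classical_sets ring.

(** Each of (1), (2) and (4) implies that [R] is clean and that no nonzero
    idempotent [g] commutes with a unit [v] such that [v - g] is a unit too.
    In a clean ring every element outside [J(R)] has a nonzero idempotent left
    multiple, so a square-zero element outside [J(R)] would yield 2x2 matrix
    units, and then the block [[1,1],[1,0]] would violate this condition.  Hence
    [g x (1 - g)] lies in [J(R)] for every idempotent [g], i.e. idempotents are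
    central modulo [J(R)].  If [u - 1] were outside [J(R)] for some unit [u],
    then for an idempotent [g = r (u - 1) <> 0] the unit [g u g + (1 - g)] would
    again violate the condition.  So units are congruent to 1 modulo [J(R)], and
    a clean decomposition [a = e + u] becomes [a = (1 - e) + (2 e - 1 + u)] with
    second summand in [J(R)].  If [J(R)] is nil, [a - a^2] is therefore always
    nilpotent, so [a] lifts to an idempotent polynomial in [a]. *)

Set Implicit Arguments.
Unset Strict Implicit.
Unset Printing Implicit Defensive.

Import GRing.Theory.
Local Open Scope ring_scope.

Section Rings.

Variable R : unitRingType.
Implicit Types (a b c e f g r s t u v w x y : R).

(** * Ring normalization, and elementary facts on units, idempotents and nilpotents *)

#[local] Instance mc_ring_ops : @Ncring.Ring_ops R 0 1 (fun x y => x + y)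
  (fun x y => x * y) (fun x y => x - y) (fun x => - x) (@eq R) := {}.

#[local] Instance mc_ring : @Ncring.Ring R _ _ _ _ _ _ _ mc_ring_ops.
Proof.
split.
- exact: eq_equivalence.
- by move=> ? ? -> ? ? ->.
- by move=> ? ? -> ? ? ->.
- by move=> ? ? -> ? ? ->.
- by move=> ? ? ->.
- by move=> x; exact (add0r x).
- by move=> x y; exact (addrC x y).
- by move=> x y z; exact (addrA x y z).
- by move=> x; exact (mul1r x).
- by move=> x; exact (mulr1 x).
- by move=> x y z; exact (mulrA x y z).
- by move=> x y z; exact (mulrDl x y z).
- by move=> x y z; exact (mulrDr z x y).
- by [].
- by move=> x; exact (subrr x).
Qed.

Lemma unit_of_inverses x y : y * x = 1 -> x * y = 1 -> x \is a GRing.unit.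
Proof. by move=> yx xy; apply/unitrP; exists y. Qed.

(** Jacobson's lemma, with inverse [1 + y * w * x]; it makes [radical] closed under right
    multiplication. *)
Lemma unit_1subMC x y :
  1 - x * y \is a GRing.unit -> 1 - y * x \is a GRing.unit.
Proof.
move=> Uxy; pose w := (1 - x * y)^-1.
have wl : w * (1 - x * y) = 1 by exact: mulVr.
have wr : (1 - x * y) * w = 1 by exact: mulrV.
apply: (@unit_of_inverses _ (1 + y * w * x)).
  have -> : (1 + y * w * x) * (1 - y * x)
    = 1 - y * x + y * (w * (1 - x * y)) * x by non_commutative_ring.
  by rewrite wl mulr1 subrK.
have -> : (1 - y * x) * (1 + y * w * x)
  = 1 - y * x + y * ((1 - x * y) * w) * x by non_commutative_ring.
by rewrite wr mulr1 subrK.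
Qed.

Lemma idempotentC e : idempotent_elt e -> idempotent_elt (1 - e).
Proof.
rewrite /idempotent_elt => ee.
have -> : (1 - e) * (1 - e) = 1 - e - e + e * e by non_commutative_ring.
by rewrite ee subrK.
Qed.

Lemma idempotent_mulC e : idempotent_elt e -> e * (1 - e) = 0.
Proof. by move=> ee; rewrite mulrBr mulr1 ee subrr. Qed.

Lemma idempotent_Cmul e : idempotent_elt e -> (1 - e) * e = 0.
Proof. by move=> ee; rewrite mulrBl mul1r ee subrr. Qed.

Lemma idempotent_double e : idempotent_elt e ->
  (e + e - 1) * (e + e - 1) = 1.
Proof.
move=> ee; have -> : (e + e - 1) * (e + e - 1)
  = (e * e - e) + (e * e - e) + (e * e - e) + (e * e - e) + 1
  by non_commutative_ring.
by rewrite ee subrr !add0r.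
Qed.

Lemma idempotent_double_unit e : idempotent_elt e ->
  e + e - 1 \is a GRing.unit.
Proof.
move=> ee; apply: (unit_of_inverses (y := e + e - 1));
  exact: idempotent_double.
Qed.

Lemma nilpotent_1sub_unit b : nilpotent_elt b -> 1 - b \is a GRing.unit.
Proof.
case=> n bn0; pose s := \sum_(i < n) b ^+ i.
have sb : (b - 1) * s = - 1 by rewrite -subrX1 bn0 sub0r.
have cs : GRing.comm (b - 1) s.
  apply: GRing.commr_sum => i _; apply/commrX/commr_sym.
  by apply: commrB => //; exact: commr1.
apply: (@unit_of_inverses _ s); first by rewrite -opprB mulrN -cs sb opprK.
by rewrite -opprB mulNr sb opprK.
Qed.

Lemma nilpotentN b : nilpotent_elt b -> nilpotent_elt (- b).
Proof. by case=> n bn; exists n; rewrite exprNn bn mulr0. Qed.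

Lemma nilpotent_1add_unit b : nilpotent_elt b -> 1 + b \is a GRing.unit.
Proof. by move=> /nilpotentN /nilpotent_1sub_unit; rewrite opprK. Qed.

(** * Elementwise description of the Jacobson radical *)

Definition radical x : Prop := forall r, 1 - r * x \is a GRing.unit.

Lemma radical_left_inverse x :
  (forall r, exists s, s * (1 - r * x) = 1) -> radical x.
Proof.
(* [s = 1 + s * r * x] is again of the form assumed left invertible, so [s] has inverses on both
   sides. *)
move=> linv r; have [s sx] := linv r; have [t] := linv (- (s * r)).
have -> : 1 - - (s * r) * x = s * (1 - r * x) + s * r * x.
  by rewrite sx mulNr opprK.
have -> : s * (1 - r * x) + s * r * x = s by non_commutative_ring.
move=> ts; apply: (unit_of_inverses sx).
by rewrite -[1 - _]mul1r -{1}ts -(mulrA t) sx mulr1.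
Qed.

(** A maximal left ideal missing [x] would give [1 = i + r * x] with [i] in it, but then
    [i = 1 - r * x] is a unit. *)
Lemma radical_jacobson x : radical x -> jacobson x.
Proof.
move=> xJ I [] [I0 I1 IM] Imax; apply: contrapT => /negP xI.
pose K : {pred R} := fun y => `[< exists i r, i \in I /\ y = i + r * x >].
have KP y : reflect (exists i r, i \in I /\ y = i + r * x) (y \in K).
  exact: asboolP.
have KI : {subset I <= K}.
  by move=> i iI; apply/KP; exists i, 0; rewrite mul0r addr0.
suff K_ideal : idealr_closed K.
  move/negP: xI; apply; apply: (Imax K K_ideal KI); apply/KP.
  by exists 0, 1; rewrite add0r mul1r.
split; first exact: KI.
  apply/negP => /KP[i [r [iI def1]]].
  have Ui : i \is a GRing.unit by rewrite -(addrK (r * x) i) -def1.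
  by move/negP: I1; apply; rewrite -(mulVr Ui) -[_ * i]addr0; exact: IM.
move=> a u v /KP[i [r [iI ->]]] /KP[j [s [jI ->]]]; apply/KP.
exists (a * i + j), (a * r + s); split; first exact: IM.
non_commutative_ring.
Qed.

(** If [1 - r * x] had no left inverse, Zorn's lemma would put it in a maximal left ideal; that
    ideal also contains [x], hence 1. *)
Lemma jacobson_radical x : jacobson x -> radical x.
Proof.
move=> xJ; apply: radical_left_inverse => r; set y := 1 - r * x.
apply: contrapT => y_noinv.
pose good (A : set R) := [/\ A y, ~ A 1
  & forall a u v, A u -> A v -> A (a * u + v)].
(* The empty set is added for the empty chain in [Zorn_bigcup]. *)
have [|A [PA Amax]] := @Zorn_bigcup R (fun A => A = set0 \/ good A).
  move=> F FP Ftot; have [[X FX Xy]|noX] := pselect (exists2 X, F X & X y).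
    right; split; first by exists X.
      by case=> Y FY Y1; case: (FP Y FY) => [Y0|[]//]; rewrite Y0 in Y1.
    move=> a u v [Y FY Yu] [Z FZ Zv].
    have cl W : F W -> W u -> W v -> W (a * u + v).
      move=> FW Wu Wv; case: (FP W FW) => [W0|[_ _ WM]]; last exact: WM.
      by rewrite W0 in Wu.
    have [YZ|ZY] := Ftot Y Z FY FZ; [exists Z|exists Y] => //; apply: cl => //.
      exact: YZ.
    exact: ZY.
  left; apply/seteqP; split=> // z [X FX Xz]; case: (FP X FX) => [X0|[Xy _ _]].
    by rewrite X0 in Xz.
  by case: noX; exists X.
have [Ay A1 AM] : good A.
  case: PA => // A0; case: (Amax [set z | exists s, z = s * y]%classic).
    rewrite A0; split=> // /(_ y) /=; apply.
    by exists 1; rewrite mul1r.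
  right; split; first by exists 1; rewrite mul1r.
    by case=> s sy; apply: y_noinv; exists s.
  by move=> a u v [s ->] [t ->]; exists (a * s + t); rewrite mulrDl mulrA.
have A0 : A 0 by rewrite -(addNr y) -mulN1r; exact: AM.
pose I : {pred R} := fun z => `[< A z >].
have IP z : reflect (A z) (z \in I) by exact: asboolP.
have Imax : maximal_left_ideal I.
  split.
    split; [exact/IP|exact/IP|move=> a u v /IP Au /IP Av; apply/IP; exact: AM].
  move=> K [K0 K1 KM] IK z zK; apply: contrapT => zI.
  apply: (Amax [set k | k \in K]%classic).
    split; first by move=> k /IP /IK.
    by move=> /(_ z zK) Az; apply: zI; exact/IP.
  by right; split=> [||a u v uK vK] /=; [exact/IK/IP|exact/negP|exact: KM].
have Ax : A x by apply/IP/xJ.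
by apply: A1; have := AM r _ _ Ax Ay; rewrite addrC subrK.
Qed.

Lemma radical_mull r x : radical x -> radical (r * x).
Proof. by move=> xJ s; rewrite mulrA. Qed.

Lemma radical_mulr x r : radical x -> radical (x * r).
Proof. by move=> xJ s; rewrite mulrA; apply: unit_1subMC; rewrite mulrA. Qed.

Lemma radicalN x : radical x -> radical (- x).
Proof. by move=> xJ; rewrite -mulN1r; exact: radical_mull. Qed.

Lemma radicalD x y : radical x -> radical y -> radical (x + y).
Proof.
move=> xJ yJ r; pose w := 1 - r * x; have Uw : w \is a GRing.unit by exact: xJ.
have -> : 1 - r * (x + y) = w * (1 - w^-1 * r * y).
  by rewrite mulrBr mulr1 !mulrA mulrV // mul1r mulrDr opprD addrA.
by rewrite unitrMl.
Qed.

Lemma radicalB x y : radical x -> radical y -> radical (x - y).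
Proof. by move=> xJ /radicalN; exact: radicalD. Qed.

Lemma radical_1sub_unit x : radical x -> 1 - x \is a GRing.unit.
Proof. by move=> /(_ 1); rewrite mul1r. Qed.

Lemma radical_idempotent e : idempotent_elt e -> radical e -> e = 0.
Proof.
move=> ee /radical_1sub_unit Ue.
by apply: (mulrI Ue); rewrite mulr0 idempotent_Cmul.
Qed.

(** * Units of clean rings modulo the radical *)

(** A violation writes the unit [v] both as [0 + v] and as [g + (v - g)], two clean decompositions
    with commuting parts. *)
Definition no_split_unit : Prop := forall g v, idempotent_elt g ->
  v \is a GRing.unit -> g * v = v * g -> v - g \is a GRing.unit -> g = 0.

(** The exchange property of clean rings: the conjugate [f] of [1 - e] by [u] satisfies
    [u * (x - f) = x * x - x], so [x - f] is a left multiple of both [x] and [1 - x]. *)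
Lemma clean_exchange x : clean R ->
  exists f c d, [/\ idempotent_elt f, f = c * x & 1 - f = d * (1 - x)].
Proof.
move=> /(_ x) [e [u [ee Uu def_x]]].
pose f := u^-1 * (1 - e) * u.
have uf : u * (x - f) = x * x - x.
  rewrite mulrBr /f !mulrA mulrV // mul1r def_x.
  have -> : u * (e + u) - (1 - e) * u
    = (e + u) * (e + u) - (e + u) - (e * e - e) by non_commutative_ring.
  by rewrite ee subrr subr0.
have xf : x - f = u^-1 * (x * x - x) by rewrite -uf mulKr.
exists f, (1 - u^-1 * (x - 1)), (1 - u^-1 * x); split.
- rewrite /idempotent_elt /f !mulrA mulrK // -(mulrA u^-1 (1 - e) (1 - e)).
  by rewrite (idempotentC ee).
- rewrite -[LHS](subKr x) xf; non_commutative_ring.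
- have -> : 1 - f = 1 - x + (x - f) by non_commutative_ring.
  rewrite xf; non_commutative_ring.
Qed.

(** Without such an idempotent, exchange applied to [r * y] can only give [f = 0], and then [d] is a
    left inverse of [1 - r * y]. *)
Lemma clean_idempotent_multiple y : clean R -> ~ radical y ->
  exists r, idempotent_elt (r * y) /\ r * y <> 0.
Proof.
move=> clR; apply: contra_notP => no_idem; apply: radical_left_inverse => r.
have [f [c [d [ff def_f def_1f]]]] := clean_exchange (r * y) clR.
have f0 : f = 0.
  apply: contrapT => f_neq0; apply: no_idem; exists (c * r).
  by rewrite -mulrA -def_f.
by exists d; rewrite -def_1f f0 subr0.
Qed.

(* [b] and [c] are the off-diagonal matrix units of a 2x2 matrix corner ring,
   [g] is its identity and [v] restricts to [[1,1],[1,0]], whose inverse is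
   [v - g]. *)
Lemma no_split_unit_matrix b c : no_split_unit ->
  b * b = 0 -> c * c = 0 -> b * c * b = b -> c * b * c = c -> b = 0.
Proof.
move=> nsu bb cc bcb cbc; pose g := c * b + b * c.
pose v := 1 - b * c + b + c.
have vl : v * (v - g) = 1.
  (* The product is expanded as 1 plus terms that each contain a factor vanishing by one of the four
     relations. *)
  have -> : v * (v - g) = 1 + (b * c * b - b) * c + (b * c * b - b) * c
    + b * (c * c) * b - (b * c * b - b) - b * (c * c) - (b * b) * c
    - (b * b) * c - (b * c * b - b) + b * b - (c * b * c - c)
    - (c * b * c - c) - (c * c) * b + c * c.
    rewrite /v /g; non_commutative_ring.
  by rewrite bcb cbc bb cc !subrr !(mul0r, mulr0, subr0, addr0).
have vr : (v - g) * v = 1.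
  have -> : (v - g) * v = 1 + (b * c * b - b) * c + (b * c * b - b) * c
    - (b * c * b - b) - (b * c * b - b) - b * (c * c) - b * (c * c)
    + c * (b * b) * c - c * (b * b) - (c * b * c - c) - (b * b) * c
    + b * b - (c * b * c - c) + c * c.
    rewrite /v /g; non_commutative_ring.
  by rewrite bcb cbc bb cc !subrr !(mul0r, mulr0, subr0, addr0).
have gg : idempotent_elt g.
  rewrite /idempotent_elt.
  have -> : g * g = (c * b * c) * b + c * (b * b) * c + b * (c * c) * b
    + (b * c * b) * c by rewrite /g; non_commutative_ring.
  by rewrite bcb cbc bb cc !(mulr0, mul0r) !addr0.
have gv : g * v = v * g.
  have -> : g * v = v * v - (v - g) * v by non_commutative_ring.
  by rewrite vr -vl; non_commutative_ring.
have g0 : g = 0.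
  apply: (nsu g v) => //; first exact: unit_of_inverses vr vl.
  exact: unit_of_inverses vl vr.
have : b * g = b by rewrite /g mulrDr !mulrA bcb bb mul0r addr0.
by rewrite g0 mulr0.
Qed.

Section CleanNoSplitUnit.

Hypotheses (clR : clean R) (nsu : no_split_unit).

Lemma radical_corner g x : idempotent_elt g -> radical (g * x * (1 - g)).
Proof.
move=> gg; apply: contrapT.
set b := g * x * (1 - g) => /(clean_idempotent_multiple clR) [y [ee]].
set e := y * b in ee *; apply.
have gb : g * b = b by rewrite /b !mulrA gg.
have bg : b * (1 - g) = b by rewrite /b -!mulrA (idempotentC gg).
have def_e : e = y * b by []; clearbody e b.
have eg : e * (1 - g) = e by rewrite def_e -mulrA bg.
have bb : b * b = 0.
  rewrite -{1}bg -{2}gb -mulrA (mulrA (1 - g)) idempotent_Cmul //.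
  by rewrite mul0r mulr0.
(* With this [c], the product [c * b = (1 - g) * e] is idempotent, so [b * c * b] and [c] satisfy
   the matrix-unit relations. *)
pose c := (1 - g) * e * y * g.
have cb : c * b = (1 - g) * e.
  by rewrite /c -!mulrA gb -def_e ee.
have cbc : c * b * c = c.
  by rewrite cb /c !mulrA -(mulrA _ e (1 - g)) eg -(mulrA _ e e) ee.
have cc : c * c = 0.
  by rewrite {2}/c /c !mulrA -(mulrA _ g) idempotent_mulC // mulr0 !mul0r.
clearbody c; have b0 : b * c * b = 0.
  apply: (@no_split_unit_matrix _ c) => //.
  - have -> : b * c * b * (b * c * b) = b * c * (b * b) * c * b.
      non_commutative_ring.
    by rewrite bb mulr0 !mul0r.
  - have -> : b * c * b * c * (b * c * b) = b * (c * b * c * b * c) * b.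
      non_commutative_ring.
    by rewrite !cbc.
  - by rewrite !mulrA cbc cbc.
have ge0 : (1 - g) * e = 0.
  by rewrite -cb -{1}cbc -!mulrA (mulrA b) b0 mulr0.
by rewrite -ee -{1}eg -mulrA ge0 mulr0.
Qed.

(** The idempotent [p = 1 - v * s] equals [p * s * v], and [p * s = p * s * (1 - p)] is radical by
    [radical_corner]; hence [p = 0]. *)
Lemma left_inverse_unit s v : s * v = 1 -> v \is a GRing.unit.
Proof.
move=> sv; pose p := 1 - v * s.
have pp : idempotent_elt p.
  rewrite /idempotent_elt.
  have -> : p * p = p - v * s + v * (s * v) * s.
    rewrite /p; non_commutative_ring.
  by rewrite sv mulr1 subrK.
have sp : s * p = 0 by rewrite /p mulrBr mulr1 mulrA sv mul1r subrr.
have ps : p * s * (1 - p) = p * s by rewrite mulrBr mulr1 -mulrA sp mulr0 subr0.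
have p0 : p = 0.
  apply: radical_idempotent => //; rewrite -[p]mulr1 -sv mulrA -ps.
  by apply: radical_mulr; exact: radical_corner.
by apply: (unit_of_inverses sv); rewrite -[LHS](subKr 1) -/p p0 subr0.
Qed.

(** In the corner of [g], [g * s * g] is a left inverse of [g * t * g] up to the error [j], which is
    radical by [radical_corner]. *)
Lemma corner_left_inverse_unit g s t : idempotent_elt g ->
  g * s * t * g = g -> g * t * g + (1 - g) \is a GRing.unit.
Proof.
move=> gg gst; pose j := g * s * (1 - g) * (t * g).
have Uj : 1 - j \is a GRing.unit.
  by apply/radical_1sub_unit/radical_mulr/radical_corner.
apply: (@left_inverse_unit ((1 - j)^-1 * (g * s * g + (1 - g)))).
rewrite -mulrA; suff -> : (g * s * g + (1 - g)) * (g * t * g + (1 - g)) = 1 - j.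
  exact: mulVr.
have -> : (g * s * g + (1 - g)) * (g * t * g + (1 - g))
  = g * s * (g * g - g) * t * g + (g * s * t * g - g) - j
    + g * s * (g * (1 - g)) + (1 - g) * g * t * g + ((1 - g) * (1 - g) + g).
  rewrite /j; non_commutative_ring.
rewrite gst gg idempotent_mulC // idempotent_Cmul // idempotentC //.
by rewrite !subrr subrK !(mulr0, mul0r) !addr0 add0r addrC.
Qed.

Lemma unit_sub1_radical u : u \is a GRing.unit -> radical (u - 1).
Proof.
move=> Uu; apply: contrapT => /(clean_idempotent_multiple clR) [r [gg]].
set g := r * (u - 1) in gg *; apply.
have def_g : g = r * (u - 1) by []; clearbody g.
apply: (nsu (v := g * u * g + (1 - g))) => //.
- by apply: (@corner_left_inverse_unit _ u^-1); rewrite // mulrVK // gg.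
- by rewrite mulrDl mulrDr !mulrA gg -(mulrA _ g g) gg idempotent_mulC //
    idempotent_Cmul.
- have -> : g * u * g + (1 - g) - g = g * (u - 1) * g + (1 - g) + (g * g - g).
    non_commutative_ring.
  rewrite gg subrr addr0; apply: (@corner_left_inverse_unit _ r) => //.
  by rewrite -(mulrA g r) -def_g !gg.
Qed.

(** The element is the difference of the units [u] and [1 - (e + e)], both congruent to 1 modulo the
    radical. *)
Lemma clean_radical_part e u : idempotent_elt e -> u \is a GRing.unit ->
  radical (e + u - (1 - e)).
Proof.
move=> ee Uu; have -> : e + u - (1 - e) = (u - 1) - (- (e + e - 1) - 1).
  non_commutative_ring.
apply: radicalB; apply: unit_sub1_radical => //.
by rewrite unitrN; exact: idempotent_double_unit.
Qed.

Lemma subr_sqr_radical a : radical (a - a * a).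
Proof.
have [e [u [ee Uu ->]]] := clR a.
have := clean_radical_part ee Uu; set j := _ - _ => jJ.
have -> : e + u = (1 - e) + j by rewrite /j [RHS]addrC subrK.
have -> : 1 - e + j - (1 - e + j) * (1 - e + j)
  = e * (1 - e) + (e * j - j * (1 - e) - j * j) by non_commutative_ring.
rewrite idempotent_mulC // add0r.
apply: radicalB; last exact: radical_mulr.
by apply: radicalB; [exact: radical_mull|exact: radical_mulr].
Qed.

End CleanNoSplitUnit.

(** * Strongly nil-clean decompositions *)

(* Newton iteration [h -> 3 h^2 - 2 h^3] for the roots of [h^2 - h]. *)
Lemma poly_idempotent_approx n : exists h r s : {poly int},
  h * h - h = s * ('X - 'X * 'X) ^+ n.+1 /\ 'X - h = r * ('X - 'X * 'X).
Proof.
elim: n => [|n [h [r [s [hh hX]]]]].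
  by exists 'X, 0, (- 1); rewrite expr1; split; ring.
set q := 'X - 'X * 'X in hh hX *.
(* The new defect contains the square of [h * h - h], so the exponent [n.+1] doubles; the surplus
   [q ^+ n] goes into the witnesses. *)
exists (3%:R * h * h - 2%:R * h * h * h), (r + s * q ^+ n * (2%:R * h - 1)),
  (- (s * s * q ^+ n * (3%:R - 2%:R * h) * (1 + 2%:R * h))); split.
  have -> :
    (3%:R * h * h - 2%:R * h * h * h) * (3%:R * h * h - 2%:R * h * h * h)
    - (3%:R * h * h - 2%:R * h * h * h)
    = - ((h * h - h) * (h * h - h) * (3%:R - 2%:R * h) * (1 + 2%:R * h)).
    by ring.
  by rewrite hh !exprS; ring.
have -> : 'X - (3%:R * h * h - 2%:R * h * h * h)
  = ('X - h) + (h * h - h) * (2%:R * h - 1) by ring.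
by rewrite hh hX exprS; ring.
Qed.

Lemma idempotent_lift a : nilpotent_elt (a - a * a) ->
  exists e, [/\ idempotent_elt e, e * a = a * e & nilpotent_elt (a - e)].
Proof.
case=> n qn0; have [h [r [s [hh hX]]]] := poly_idempotent_approx n.
(* Integer constants commute with [a], so polynomials over [int] can be evaluated at [a] although
   [R] need not be commutative. *)
have ca : commr_rmorph (intr : int -> R) a by move=> z; exact: commr_int.
pose phi : {rmorphism {poly int} -> R} := horner_morph ca.
have phiX : phi 'X = a by exact: horner_morphX.
have phiq (m : nat) : (n <= m)%N -> phi (('X - 'X * 'X) ^+ m) = 0.
  move=> nm; rewrite rmorphXn rmorphB rmorphM phiX.
  by rewrite -(subnKC nm) exprD qn0 mul0r.
exists (phi h); split.
- by apply/eqP; rewrite -subr_eq0 -rmorphM -rmorphB hh rmorphM phiq ?mulr0.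
- by rewrite -phiX -!rmorphM mulrC.
- exists n; rewrite -phiX -rmorphB hX -rmorphXn exprMn rmorphM phiq //.
  by rewrite mulr0.
Qed.

Lemma mulr_exp_congr g x y n : GRing.comm g y -> g * x = g * y ->
  g * x ^+ n = g * y ^+ n.
Proof.
move=> gy gxy; elim: n => // n IHn.
by rewrite !exprSr !mulrA IHn (commrX n gy) -!mulrA gxy.
Qed.

(** Under [e], [a ^+ n] acts as the unit [w = (1 + (a - e)) ^+ n]; under [1 - f] it acts as
    [(a - f) ^+ n = 0]. Hence [w * e * (1 - f) = e * a ^+ n * (1 - f) = 0]. *)
Lemma nil_clean_idempotent_le a e f :
  idempotent_elt e -> idempotent_elt f -> e * a = a * e -> f * a = a * f ->
  nilpotent_elt (a - e) -> nilpotent_elt (a - f) -> e * (1 - f) = 0.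
Proof.
move=> ee ff ea fa eN [n fn].
have Uw : (1 + (a - e)) ^+ n \is a GRing.unit.
  by apply: unitrX; exact: nilpotent_1add_unit.
have ew : GRing.comm e (1 + (a - e)).
  by apply: commrD; [exact: commr1|apply: commrB].
have fw : GRing.comm (1 - f) (a - f).
  by rewrite /GRing.comm !mulrBr !mulrBl !mul1r !mulr1 fa; non_commutative_ring.
have fa0 : (1 - f) * a ^+ n = 0.
  rewrite (@mulr_exp_congr _ _ (a - f)) // ?fn ?mulr0 //.
  by rewrite mulrBr idempotent_Cmul // subr0.
have ea1 : e * a ^+ n = e * (1 + (a - e)) ^+ n.
  apply: mulr_exp_congr => //.
  have -> : e * (1 + (a - e)) = e * (1 - e) + e * a by non_commutative_ring.
  by rewrite idempotent_mulC // add0r.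
have fan : GRing.comm (1 - f) (a ^+ n).
  by apply/commrX; rewrite /GRing.comm mulrBr mulrBl mul1r mulr1 fa.
apply: (mulrI Uw); rewrite mulr0 mulrA -(commrX n ew) -ea1.
by rewrite -mulrA -fan fa0 mulr0.
Qed.

Lemma strongly_nil_clean_unique a e f :
  idempotent_elt e -> idempotent_elt f -> e * a = a * e -> f * a = a * f ->
  nilpotent_elt (a - e) -> nilpotent_elt (a - f) -> e = f.
Proof.
move=> ee ff ea fa eN fN.
have /eqP := nil_clean_idempotent_le ee ff ea fa eN fN.
rewrite mulrBr mulr1 subr_eq0 => /eqP ->.
have cC x : x * a = a * x -> (1 - x) * (1 - a) = (1 - a) * (1 - x).
  by move=> xa; rewrite !mulrBr !mulrBl !mul1r !mulr1 xa; non_commutative_ring.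
have nC x : nilpotent_elt (a - x) -> nilpotent_elt (1 - a - (1 - x)).
  by move=> /nilpotentN; congr nilpotent_elt; non_commutative_ring.
(* Passing to [1 - a] gives [(1 - e) * f = 0]; with [e * (1 - f) = 0], both idempotents equal
   [e * f], whether or not [e] and [f] commute. *)
have := nil_clean_idempotent_le (idempotentC ee) (idempotentC ff)
  (cC e ea) (cC f fa) (nC e eN) (nC f fN).
by rewrite subKr mulrBl mul1r => /eqP; rewrite subr_eq0 => /eqP.
Qed.

Lemma strongly_nil_clean_subr_sqr a : strongly_nil_clean R ->
  nilpotent_elt (a - a * a).
Proof.
move=> /(_ a) [e [b [ee [n bn] eb ->]]].
have -> : e + b - (e + b) * (e + b)
  = b * (1 - e - e - b) + (e * b - b * e) * (0 - 1) - (e * e - e)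
  by non_commutative_ring.
rewrite ee eb !subrr mul0r addr0 subr0; exists n.
rewrite exprMn_comm ?bn ?mul0r //.
by do !apply: commrB => //; exact: commr1.
Qed.

(** * Implications between the four conditions *)

Lemma unit_uniquely_clean_no_split_unit :
  unit_uniquely_clean R -> no_split_unit.
Proof.
case=> _ uuc g v gg Uv gv Uvg.
have [||w Uw g0] := uuc g 0 (v - g) v gg _ Uvg Uv.
- exact: mulr0.
- by rewrite add0r addrC subrK.
- by rewrite g0 mulr0 mul0r.
Qed.

Lemma strongly_uniquely_clean_no_split_unit :
  strongly_uniquely_clean R -> no_split_unit.
Proof.
move=> suc g v gg Uv gv Uvg; have [p [_ p_uniq]] := suc v.
suff: (0, v) = (g, v - g) by case.
rewrite -(p_uniq (0, v)) -1?(p_uniq (g, v - g)) //; split=> //=.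
- by rewrite mulrBr mulrBl gv.
- by rewrite addrC subrK.
- exact: mulr0.
- by rewrite mul0r mulr0.
- by rewrite add0r.
Qed.

(** [v * (1 - v)] is nilpotent, so [1 - v] is; as [g * (g - v) ^+ n = g * (1 - v) ^+ n], some power
    of the unit [g - v] annihilates [g]. *)
Lemma strongly_nil_clean_no_split_unit : strongly_nil_clean R -> no_split_unit.
Proof.
move=> snc g v gg Uv gv Uvg.
have [n] := strongly_nil_clean_subr_sqr v snc.
have -> : v - v * v = v * (1 - v) by rewrite mulrBr mulr1.
have cv : GRing.comm v (1 - v) by apply: commrB => //; exact: commr1.
rewrite exprMn_comm // => v1n.
have {v1n} v1n : (1 - v) ^+ n = 0.
  by apply: (mulrI (unitrX n Uv)); rewrite v1n mulr0.
have : g * (g - v) ^+ n = g * (1 - v) ^+ n.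
  apply: mulr_exp_congr; first by apply: commrB => //; exact: commr1.
  by rewrite !mulrBr gg mulr1.
rewrite v1n mulr0 => gn.
have Un : (g - v) ^+ n \is a GRing.unit by rewrite unitrX // -opprB unitrN.
by apply: (mulIr Un); rewrite gn mul0r.
Qed.

Lemma strongly_uniquely_clean_clean : strongly_uniquely_clean R -> clean R.
Proof.
by move=> suc a; have [[e u] [[ee Uu _ ->] _]] := suc a; exists e, u.
Qed.

(** The sum [e + b] is regrouped as [(1 - e) + (d + b)] with [d = e + e - 1] of square 1;
    [d + b = d * (1 + d * b)] is a unit because [d * b] is nilpotent. *)
Lemma strongly_nil_clean_decomposition a : strongly_nil_clean R ->
  exists e u,
    [/\ idempotent_elt e, u \is a GRing.unit, e * u = u * e & a = e + u].
Proof.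
move=> /(_ a) [e [b [ee bN eb ->]]].
pose d := e + e - 1; have dd : d * d = 1 by exact: idempotent_double.
have db : GRing.comm d b.
  by rewrite /GRing.comm /d mulrBl mulrDl eb mul1r mulrBr mulrDr mulr1.
have dbN : nilpotent_elt (d * b).
  by case: bN => n bn; exists n; rewrite exprMn_comm // bn mulr0.
exists (1 - e), (d + b); split.
- exact: idempotentC.
- have -> : d + b = d * (1 + d * b) by rewrite mulrDr mulr1 mulrA dd mul1r.
  by rewrite unitrMl ?idempotent_double_unit //; exact: nilpotent_1add_unit.
- rewrite mulrBl mulrBr mul1r mulr1 mulrDr mulrDl eb /d; congr (_ - (_ + _)).
  non_commutative_ring.
- rewrite /d; non_commutative_ring.
Qed.

Lemma strongly_nil_clean_clean : strongly_nil_clean R -> clean R.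
Proof.
move=> snc a.
have [e [u [ee Uu _ ->]]] := strongly_nil_clean_decomposition a snc.
by exists e, u.
Qed.

(** For [x = e + b] in the radical, [1 - e = (1 + b) - x] is a unit minus a radical element, hence a
    unit, so [e = 0]. *)
Lemma strongly_nil_clean_jacobson_nil : strongly_nil_clean R -> jacobson_nil R.
Proof.
move=> snc x /jacobson_radical xJ; have [e [b [ee bN eb def_x]]] := snc x.
have U1b := nilpotent_1add_unit bN.
suff e0 : e = 0 by rewrite def_x e0 add0r.
have Ue : 1 - e \is a GRing.unit.
  have -> : 1 - e = (1 + b) * (1 - (1 + b)^-1 * x).
    rewrite mulrBr mulr1 mulVKr // def_x; non_commutative_ring.
  by rewrite unitrMl.
by apply: (mulrI Ue); rewrite mulr0 idempotent_Cmul.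
Qed.

Lemma unit_uniquely_clean_strongly_nil_clean :
  unit_uniquely_clean R -> jacobson_nil R -> strongly_nil_clean R.
Proof.
move=> uuc Jnil a.
have /radical_jacobson /Jnil /idempotent_lift [e [ee ea aeN]] :=
  subr_sqr_radical uuc.1 (unit_uniquely_clean_no_split_unit uuc) a.
by exists e, (a - e); rewrite mulrBr mulrBl ea [e + _]addrC subrK.
Qed.

(** Replacing [e] by [1 - e] turns a strongly clean decomposition into a strongly nil-clean one, so
    uniqueness comes from [strongly_nil_clean_unique]. *)
Lemma strongly_nil_clean_strongly_uniquely_clean :
  strongly_nil_clean R -> strongly_uniquely_clean R.
Proof.
move=> snc a.
have dec_nil e u : [/\ idempotent_elt e, u \is a GRing.unit, e * u = u * e
    & a = e + u] -> (1 - e) * a = a * (1 - e) /\ nilpotent_elt (a - (1 - e)).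
  case=> ee Uu eu ->; split.
    rewrite mulrBl mulrBr mul1r mulr1; congr (_ - _).
    by rewrite mulrDr mulrDl eu.
  apply: (strongly_nil_clean_jacobson_nil snc); apply: radical_jacobson.
  apply: clean_radical_part => //; first exact: strongly_nil_clean_clean.
  exact: strongly_nil_clean_no_split_unit.
have [e [u eu]] := strongly_nil_clean_decomposition a snc.
exists (e, u); split=> // -[f v] fv.
have [ea eN] := dec_nil e u eu; have [fa fN] := dec_nil f v fv.
case: eu fv => ee _ _ def_a /= [ff _ _ def_a'].
have ef : e = f.
  apply: oppr_inj; apply: (addrI 1).
  by apply: (strongly_nil_clean_unique (a := a)) => //; exact: idempotentC.
by rewrite -ef in def_a' *; rewrite -(addKr e u) -def_a def_a' addKr.
Qed.

Lemma strongly_uniquely_clean_strongly_J_clean :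
  strongly_uniquely_clean R -> strongly_J_clean R.
Proof.
move=> suc a; have [[e u] [/= [ee Uu eu def_a] _]] := suc a.
exists (1 - e), (a - (1 - e)); split.
- exact: idempotentC.
- rewrite def_a; apply: radical_jacobson; apply: clean_radical_part => //.
    exact: strongly_uniquely_clean_clean.
  exact: strongly_uniquely_clean_no_split_unit.
- have: (1 - e) * a = a * (1 - e).
    by rewrite mulrBl mulrBr mul1r mulr1 def_a mulrDr mulrDl eu.
  by move=> ea; rewrite [LHS]mulrBr [RHS]mulrBl ea.
- by rewrite addrC subrK.
Qed.

(** The intertwiner [u], with [f * u = u * e], is congruent to 1 modulo the radical because [e] and
    [f] agree there. *)
Lemma unit_conj_radical e f : idempotent_elt e -> idempotent_elt f ->
  radical (e - f) -> unit_conj e f.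
Proof.
move=> ee ff efJ; pose u := f * e + (1 - f) * (1 - e).
have Uu : u \is a GRing.unit.
  have -> : u = 1 - ((e - f) * e - f * (e - f)).
    have -> : 1 - ((e - f) * e - f * (e - f))
      = u - (e * e - e) - (f * f - f) by rewrite /u; non_commutative_ring.
    by rewrite ee ff !subrr !subr0.
  by apply/radical_1sub_unit/radicalB;
    [exact: radical_mulr | exact: radical_mull].
exists u => //.
have fu : f * u = u * e.
  have -> : f * u = f * f * e + f * (1 - f) * (1 - e).
    rewrite /u; non_commutative_ring.
  have -> : u * e = f * (e * e) + (1 - f) * ((1 - e) * e).
    rewrite /u; non_commutative_ring.
  by rewrite ee ff idempotent_mulC // idempotent_Cmul // mul0r mulr0.
by rewrite -mulrA fu mulKr.
Qed.

Lemma strongly_nil_clean_unit_uniquely_clean :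
  strongly_nil_clean R -> unit_uniquely_clean R.
Proof.
move=> snc; have clR := strongly_nil_clean_clean snc.
have nsu := strongly_nil_clean_no_split_unit snc.
split=> // e f u v ee ff Uu Uv euv; apply: unit_conj_radical => //.
have -> : e - f = (v - 1) - (u - 1).
  by rewrite -[e](addrK u) euv; non_commutative_ring.
by apply: radicalB; exact: unit_sub1_radical.
Qed.

Lemma strongly_J_clean_strongly_nil_clean :
  strongly_J_clean R -> jacobson_nil R -> strongly_nil_clean R.
Proof.
by move=> sjc Jnil a; have [e [j [ee /Jnil jN ej ->]]] := sjc a; exists e, j.
Qed.

End Rings.

Theorem corollary2p16 (R : unitRingType) :
  [<-> unit_uniquely_clean R /\ jacobson_nil R;
       strongly_uniquely_clean R /\ jacobson_nil R;
       strongly_J_clean R /\ jacobson_nil R;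
       strongly_nil_clean R].
Proof.
tfae.
- case=> uuc Jnil; split=> //.
  apply: strongly_nil_clean_strongly_uniquely_clean.
  exact: unit_uniquely_clean_strongly_nil_clean.
- by case=> /strongly_uniquely_clean_strongly_J_clean.
- by case; exact: strongly_J_clean_strongly_nil_clean.
- move=> snc; split; first exact: strongly_nil_clean_unit_uniquely_clean.
  exact: strongly_nil_clean_jacobson_nil.
Qed.
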